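(* Let $M$ be a nonempty set, let $d$ be an almost metric on $M$, and let $\varphi:M\to\mathbb{R}\cup\{\infty\}$ be an inf-proper function such that $(d,\varphi)$ is descending complete. Let $b:\mathbb{R}_+\to\mathbb{R}_+$ be a normal function with $B(t)=\int_0^t b(\tau)\,d\tau$, let $\Gamma:M\to\mathbb{R}_+$ be almost $d$-nonexpansive, and let $e=e(B,\Gamma;d)$ be the Zhong metric $e(x,y)=B(\Gamma(x)+d(x,y))-B(\Gamma(x))$, $x,y\in M$. Then: (viii) For each $u\in \mathrm{Dom}(\varphi)$ there exists $v=v(u)\in \mathrm{Dom}(\varphi)$ with $$b(\Gamma(u)+d(u,v))\,d(u,v)\le e(u,v)\le \varphi(u)-\varphi(v),\qquad (1)$$ $$b(\Gamma(v))\,d(v,x)\ge e(v,x)>\varphi(v)-\varphi(x)\quad\text{for all } x\in M\setminus\{v\}.\qquad (2)$$ (ix) For each $u\in \mathrm{Dom}(\varphi)$ and $\rho>0$ with $\varphi(u)-\varphi_*\le B(\Gamma(u)+\rho)-B(\Gamma(u))$, the evaluation (1) (for a point $v\in\mathrm{Dom}(\varphi)$) implies $$d(u,v)\le\rho,\quad\text{hence } \Gamma(v)\le\Gamma(u)+\rho,$$ $$b(\Gamma(u)+\rho)\,d(u,v)\le\varphi(u)-\varphi(v),\quad\text{hence } \varphi(u)\ge\varphi(v).$$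
   Context: $\mathbb{R}_+=[0,\infty)$. An almost metric on $M$ is a map $d:M\times M\to\mathbb{R}_+$ (not necessarily symmetric) that is triangular, $d(x,z)\le d(x,y)+d(y,z)$ for all $x,y,z$, and reflexive sufficient, $d(x,y)=0\iff x=y$. A sequence $(x_n)$ is $d$-Cauchy if for each $\delta>0$ there is $n(\delta)$ such that $n(\delta)\le p\le q$ implies $d(x_p,x_q)\le\delta$. We write $x_n\stackrel{d}{\to}x$ iff $d(x_n,x)\to 0$ as $n\to\infty$. For $\varphi:M\to\mathbb{R}\cup\{\infty\}$, $\mathrm{Dom}(\varphi)=\{x\in M:\varphi(x)<\infty\}$ and $\varphi_*=\inf\varphi(M)$; $\varphi$ is inf-proper if $\mathrm{Dom}(\varphi)\neq\emptyset$ and $\varphi_*>-\infty$. The pair $(d,\varphi)$ is descending complete if for each $d$-Cauchy sequence $(x_n)$ in $\mathrm{Dom}(\varphi)$ with $(\varphi(x_n))$ descending (nonincreasing) there exists $x\in M$ with $x_n\stackrel{d}{\to}x$ and $\lim_n\varphi(x_n)\ge\varphi(x)$. A function $b:\mathbb{R}_+\to\mathbb{R}_+$ is normal if it is decreasing (in the non-strict sense), $b(\mathbb{R}_+)\subseteq(0,\infty)$, and $B(\infty)=\infty$, where $B(t)=\int_0^t b(\tau)\,d\tau$ for $t\ge0$ (i.e. $B(t)\to\infty$ as $t\to\infty$). A function $\Gamma:M\to\mathbb{R}_+$ is almost $d$-nonexpansive if $\Gamma(x)-\Gamma(y)+d(x,y)\ge0$ for all $x,y\in M$. *)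

(* Defs.v *)
From mathcomp Require Import all_boot all_order all_algebra.
From mathcomp Require Import all_classical all_reals all_analysis.

Set Implicit Arguments.
Unset Strict Implicit.
Unset Printing Implicit Defensive.

Import Order.TTheory GRing.Theory Num.Theory.
Import numFieldNormedType.Exports.

Local Open Scope classical_set_scope.
Local Open Scope ring_scope.

(* Maps with values in R_+ = [0, +oo[ are R-valued maps with a nonnegativity
   hypothesis. Not assumed symmetric. *)
Definition almost_metric (R : realType) (M : Type) (d : M -> M -> R) : Prop :=
  [/\ forall x y, 0 <= d x y,
      forall x y z, d x z <= d x y + d y z
    & forall x y, d x y = 0 <-> x = y].

(* d is not symmetric: only d (x p) (x q) with p <= q is controlled. *)
Definition d_cauchy (R : realType) (M : Type) (d : M -> M -> R)
    (x : nat -> M) : Prop :=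
  forall delta : R, 0 < delta ->
    exists n : nat, forall p q : nat, (n <= p)%N -> (p <= q)%N ->
      d (x p) (x q) <= delta.

Definition d_converges (R : realType) (M : Type) (d : M -> M -> R)
    (x : nat -> M) (l : M) : Prop :=
  d (x n) l @[n --> \oo] --> (0 : R).

Definition edom (R : realType) (M : Type) (phi : M -> \bar R) : set M :=
  [set x | (phi x < +oo)%E].

Definition inf_value (R : realType) (M : Type) (phi : M -> \bar R) : \bar R :=
  ereal_inf (range phi).

Definition inf_proper (R : realType) (M : Type) (phi : M -> \bar R) : Prop :=
  edom phi !=set0 /\ (-oo < inf_value phi)%E.

(* The limit of phi (x n) is taken in \bar R; it always exists, since the
   sequence is nonincreasing. *)
Definition descending_complete (R : realType) (M : Type) (d : M -> M -> R)
    (phi : M -> \bar R) : Prop :=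
  forall x : nat -> M,
    (forall n, edom phi (x n)) -> d_cauchy d x ->
    nonincreasing_seq (fun n => phi (x n)) ->
    exists l : M, d_converges d x l /\
      (phi l <= lim (phi (x n) @[n --> \oo]))%E.

(* The values of b on negative reals are irrelevant. *)
Definition primitive0 (R : realType) (b : R -> R) (t : R) : R :=
  \int[lebesgue_measure]_(tau in `[0, t]) b tau.

Definition normal_function (R : realType) (b : R -> R) : Prop :=
  [/\ forall s t, 0 <= s -> s <= t -> b t <= b s,
      forall t, 0 <= t -> 0 < b t
    & primitive0 b t @[t --> +oo] --> +oo].

Definition almost_nonexpansive (R : realType) (M : Type) (d : M -> M -> R)
    (Gamma : M -> R) : Prop :=
  forall x y, 0 <= Gamma x - Gamma y + d x y.

Definition zhong_metric (R : realType) (M : Type) (B : R -> R)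
    (Gamma : M -> R) (d : M -> M -> R) (x y : M) : R :=
  B (Gamma x + d x y) - B (Gamma x).

(* Main.v *)
Require Import Defs.
From mathcomp Require Import all_boot all_order all_algebra.
From mathcomp Require Import all_classical all_reals all_analysis.
From mathcomp Require Import measurable_realfun ring lra.

(** The Zhong metric [e] is again an almost metric, it inherits descending
    completeness from [d], and the existence part is Ekeland's variational
    principle for [e]; the products with [b] come from comparing the increment
    of [B] over an interval with the values of [b] at the two ends.

    Since [b] is nonincreasing and positive, that comparison
    ([primitive0_slope]),
      [b t * (t - s) <= B t - B s <= b s * (t - s)] for [0 <= s <= t],
    gives all that is used about [B] besides its divergence: strict monotonicity
    and concavity, the latter in the form that [B (t + h) - B t] does not
    increase with [t] ([primitive0_increment_anti]). As [Gamma y <= Gamma x + d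
    x y], concavity turns the triangle inequality of [d] into that of [e]
    ([zhong_almost_metric]).

    For completeness, [e x y <= b 0 * d x y] shows that [d]-convergence implies
    [e]-convergence. The opposite comparison needs a positive lower bound on
    [b], which in general exists only on bounded intervals. An [e]-Cauchy
    sequence provides one: [B] is unbounded, so a bounded [e]-distance bounds
    [Gamma x + d x y] ([zhong_le_bounded]), the arguments of [b] stay below some
    [L], and [b L * d <= e] along the sequence ([zhong_cauchy]).

    Ekeland's principle ([ekeland]) concerns the order in which [y] is below [x]
    when [phi y + e x y <= phi x]. Its lower sections [S x] are nested along a
    chain of almost minimizers; completeness gives a limit lying in all of them,
    and this limit is minimal.

    For the localization of [v], [e u v] is at most [phi u - inf phi], hence at
    most [B (Gamma u + rho) - B (Gamma u)]; strict monotonicity of [B] then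
    bounds [d u v] by [rho], and monotonicity of [b] gives the rest. *)

Set Implicit Arguments.
Unset Strict Implicit.
Unset Printing Implicit Defensive.

Import Order.TTheory GRing.Theory Num.Theory.
Import numFieldNormedType.Exports.

Local Open Scope classical_set_scope.
Local Open Scope ring_scope.

(** * Increments of the primitive *)

(** On [`[0, t]] the function lies between [0] and [b 0], and it is monotone,
    hence measurable. *)
Lemma normal_integrable (R : realType) (b : R -> R) (t : R) :
  normal_function b ->
  lebesgue_measure.-integrable `[0, t] (EFin \o b).
Proof.
move=> [bmono bpos _].
apply: measurable_bounded_integrable => //.
- rewrite /= lebesgue_measure_itv /=; case: ifP => _ //.
  by rewrite -EFinB ltry.
- rewrite /=.
  (* Precomposing with [max 0] makes [b] monotone on the whole line, whatever
     its values on negative reals. *)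
  apply: (eq_measurable_fun (fun x : measurableTypeR R => b (Num.max 0 x))).
    by move=> x; rewrite inE /= in_itv /= => /andP[x0 _]; rewrite (max_idPr x0).
  apply: nonincreasing_measurable => // x y xy.
  apply: bmono; first by rewrite le_max lexx.
  by rewrite ge_max !le_max lexx xy orbT.
- exists (b 0); split; first exact: num_real.
  move=> K bK x /=; rewrite in_itv /= => /andP[x0 _].
  by rewrite ger0_norm ?(ltW (bpos _ _)) // (le_trans (bmono _ _ _ x0)) // ltW.
Qed.

(** [B t - B s] is the integral of [b] over an interval of length [t - s] on
    which [b t <= b <= b s]. *)
Lemma primitive0_slope (R : realType) (b : R -> R) (s t : R) :
  normal_function b -> 0 <= s -> s <= t ->
  b t * (t - s) <= primitive0 b t - primitive0 b s <= b s * (t - s).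
Proof.
move=> hb s0 st; have [bmono bpos _] := hb.
have it := normal_integrable t hb.
rewrite /primitive0 Rintegral_itvB //= ?bnd_simp //.
have ist : lebesgue_measure.-integrable `]s, t] (EFin \o b).
  apply: integrableS it => //= x /=; rewrite !in_itv /= => /andP[sx ->].
  by rewrite (le_trans s0 (ltW sx)).
have lst : fine (lebesgue_measure (`]s, t] : set R)) = t - s.
  rewrite lebesgue_measure_itv /=; case: ifP => //= /negbT.
  by rewrite lte_fin -leNgt => ts; lra.
have icst c : lebesgue_measure.-integrable `]s, t] (EFin \o (fun _ : R => c)).
  apply: measurable_bounded_integrable => //.
  - rewrite /= lebesgue_measure_itv /=; case: ifP => _ //.
    by rewrite -EFinB ltry.
  - exact: bounded_cst.
apply/andP; split.
- rewrite -lst -Rintegral_cst //; apply: le_Rintegral => //.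
  move=> x /=; rewrite in_itv /= => /andP[sx xt].
  by apply: bmono => //; rewrite (le_trans s0 (ltW sx)).
- rewrite -lst -Rintegral_cst //; apply: le_Rintegral => //.
  move=> x /=; rewrite in_itv /= => /andP[sx xt].
  by apply: bmono => //; rewrite ltW.
Qed.

Lemma primitive0_lt (R : realType) (b : R -> R) (s t : R) :
  normal_function b -> 0 <= s -> s < t -> primitive0 b s < primitive0 b t.
Proof.
move=> hb s0 st; have [_ bpos _] := hb.
have /andP[lo _] := primitive0_slope hb s0 (ltW st).
rewrite -subr_gt0; apply: lt_le_trans lo.
by rewrite mulr_gt0 ?subr_gt0 // bpos // (le_trans s0 (ltW st)).
Qed.

Lemma primitive0_le (R : realType) (b : R -> R) (s t : R) :
  normal_function b -> 0 <= s -> s <= t -> primitive0 b s <= primitive0 b t.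
Proof.
move=> hb s0; rewrite le_eqVlt => /predU1P[->|st] //.
exact/ltW/primitive0_lt.
Qed.

(** Concavity of the primitive: after removing the common part of the two
    intervals, what is left are two disjoint intervals of equal length, the one
    on the right carrying the smaller values of [b]. *)
Lemma primitive0_increment_anti (R : realType) (b : R -> R) (s t h : R) :
  normal_function b -> 0 <= s -> s <= t -> 0 <= h ->
  primitive0 b (t + h) - primitive0 b t <=
  primitive0 b (s + h) - primitive0 b s.
Proof.
move=> hb s0 st h0; have [bmono _ _] := hb.
(* If the intervals overlap, [`[t, s + h]] is common to both and the leftovers
   are [`[s, t]] and [`[s + h, t + h]], of length [t - s]. *)
have [sht|tsh] := leP (s + h) t.
  have sh : s <= s + h by lra.
  have th : t <= t + h by lra.
  have /andP[lo _] := primitive0_slope hb s0 sh.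
  have /andP[_ up] := primitive0_slope hb (le_trans s0 st) th.
  apply: le_trans up (le_trans _ lo).
  have -> : t + h - t = h by ring.
  have -> : s + h - s = h by ring.
  by apply: ler_wpM2r => //; apply: bmono => //; lra.
have /andP[lo _] := primitive0_slope hb s0 st.
have sh0 : 0 <= s + h by lra.
have shth : s + h <= t + h by lra.
have /andP[_ up] := primitive0_slope hb sh0 shth.
have bts : b (s + h) <= b t by apply: bmono; lra.
have : b (s + h) * (t - s) <= b t * (t - s) by apply: ler_wpM2r => //; lra.
have : t + h - (s + h) = t - s by ring.
by move=> eq_len; rewrite eq_len in up; lra.
Qed.

(** * The Zhong metric *)

Lemma zhong_bounds (R : realType) (M : Type) (d : M -> M -> R)
    (b : R -> R) (Gamma : M -> R) (x y : M) :
  normal_function b -> (forall z, 0 <= Gamma z) -> 0 <= d x y ->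
  b (Gamma x + d x y) * d x y <= zhong_metric (primitive0 b) Gamma d x y
    <= b (Gamma x) * d x y.
Proof.
move=> hb G0 dxy; rewrite /zhong_metric.
have := @primitive0_slope _ b (Gamma x) (Gamma x + d x y) hb (G0 x).
by rewrite lerDl [Gamma x + d x y - _]addrAC subrr add0r; exact.
Qed.

(** Concavity gives the triangle inequality: starting the second increment at
    [Gamma x + d x y], beyond [Gamma y], makes it smaller. Strict monotonicity
    of the primitive separates the points. *)
Lemma zhong_almost_metric (R : realType) (M : Type) (d : M -> M -> R)
    (b : R -> R) (Gamma : M -> R) :
  almost_metric d -> normal_function b -> (forall z, 0 <= Gamma z) ->
  almost_nonexpansive d Gamma ->
  almost_metric (zhong_metric (primitive0 b) Gamma d).
Proof.
move=> [d0 dtri deq] hb G0 Gd; rewrite /zhong_metric; split.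
- by move=> x y; rewrite subr_ge0 primitive0_le // lerDl.
- move=> x y z.
  have Gyx : Gamma y <= Gamma x + d x y by have := Gd x y; lra.
  have := primitive0_increment_anti hb (G0 y) Gyx (d0 y z).
  have : primitive0 b (Gamma x + d x z) <=
         primitive0 b (Gamma x + d x y + d y z).
    apply: primitive0_le => //; first by rewrite addr_ge0.
    by rewrite -addrA lerD2l.
  lra.
- move=> x y; split=> [|<-]; last first.
    by rewrite ((deq x x).2 erefl) addr0 subrr.
  move=> exy; apply/deq/eqP/negPn/negP => dN0.
  have dxy : 0 < d x y by rewrite lt_def dN0 d0.
  have : primitive0 b (Gamma x) < primitive0 b (Gamma x + d x y).
    by apply: primitive0_lt => //; rewrite ltrDl.
  lra.
Qed.

(** This is where divergence of the primitive enters: without it, points at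
    [e]-distance at most [1] could be arbitrarily far apart for [d]. The bound
    [1] is an arbitrary normalization. *)
Lemma zhong_le_bounded (R : realType) (M : Type) (d : M -> M -> R)
    (b : R -> R) (Gamma : M -> R) (K : R) :
  normal_function b -> (forall z, 0 <= Gamma z) -> 0 <= K ->
  exists2 K' : R, 0 <= K' &
    forall x y, 0 <= d x y -> Gamma x <= K ->
      zhong_metric (primitive0 b) Gamma d x y <= 1 -> Gamma x + d x y <= K'.
Proof.
move=> hb G0 K0; have [_ _ /cvgryPgt /(_ (primitive0 b K + 1))] := hb.
move=> [A [_ BA]].
exists (Num.max 0 (A + 1)); first by rewrite le_max lexx.
move=> x y dxy GK exy; rewrite leNgt; apply/negP.
rewrite gt_max => /andP[_ Alt].
have := BA (Gamma x + d x y) (lt_trans _ Alt).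
rewrite ltrDl => /(_ ltr01).
have := primitive0_le hb (G0 x) GK.
move: exy; rewrite /zhong_metric; lra.
Qed.

(** [d] and [e] are comparable only as long as the argument of [b] stays
    bounded, so the boundedness lemma is applied twice: from the fixed index
    [N], to bound [Gamma] along the tail, and then from every index of the tail,
    to bound [Gamma (x p) + d (x p) (x q)] uniformly. *)
Lemma zhong_cauchy (R : realType) (M : Type) (d : M -> M -> R)
    (b : R -> R) (Gamma : M -> R) (x : nat -> M) :
  almost_metric d -> normal_function b -> (forall z, 0 <= Gamma z) ->
  almost_nonexpansive d Gamma ->
  d_cauchy (zhong_metric (primitive0 b) Gamma d) x -> d_cauchy d x.
Proof.
move=> [d0 _ _] hb G0 Gd xC.
have [N xN] := xC 1 ltr01.
have [K K0 HK] := zhong_le_bounded d hb G0 (G0 (x N)).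
have GK q : (N <= q)%N -> Gamma (x q) <= K.
  move=> Nq; have := HK _ _ (d0 _ _) (lexx _) (xN N q (leqnn N) Nq).
  by have := Gd (x N) (x q); lra.
(* [K] bounds [Gamma] on the tail; [L] bounds all the arguments of [b]. *)
have [L L0 HL] := zhong_le_bounded d hb G0 K0.
have [bmono bpos _] := hb.
move=> delta delta0.
have [N' xN'] := xC (b L * delta) (mulr_gt0 (bpos _ L0) delta0).
exists (maxn N N') => p q; rewrite geq_max => /andP[Np N'p] pq.
have epq1 := xN p q Np pq.
have epq := xN' p q N'p pq.
have pL := HL _ _ (d0 _ _) (GK p Np) epq1.
rewrite -(ler_pM2l (bpos _ L0)); apply: le_trans epq.
have /andP[lo _] := zhong_bounds hb G0 (d0 (x p) (x q)).
apply: le_trans lo; apply: ler_wpM2r => //.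
by apply: bmono => //; rewrite addr_ge0.
Qed.

Lemma zhong_converges (R : realType) (M : Type) (d : M -> M -> R)
    (b : R -> R) (Gamma : M -> R) (x : nat -> M) (l : M) :
  almost_metric d -> normal_function b -> (forall z, 0 <= Gamma z) ->
  d_converges d x l -> d_converges (zhong_metric (primitive0 b) Gamma d) x l.
Proof.
move=> [d0 _ _] hb G0 xl; have [bmono bpos _] := hb.
apply: (@squeeze_cvgr _ _ _ _ (fun=> 0) (fun n => b 0 * d (x n) l)).
- apply: nearW => n.
  have /andP[lo up] := zhong_bounds hb G0 (d0 (x n) l).
  apply/andP; split.
    by apply: le_trans lo; rewrite mulr_ge0 // ltW // bpos // addr_ge0.
  by apply: le_trans up _; apply: ler_wpM2r => //; apply: bmono.
- exact: cvg_cst.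
- by rewrite -[X in _ --> X](mulr0 (b 0)); apply: cvgM => //; exact: cvg_cst.
Qed.

Lemma zhong_descending_complete (R : realType) (M : Type) (d : M -> M -> R)
    (phi : M -> \bar R) (b : R -> R) (Gamma : M -> R) :
  almost_metric d -> normal_function b -> (forall z, 0 <= Gamma z) ->
  almost_nonexpansive d Gamma -> descending_complete d phi ->
  descending_complete (zhong_metric (primitive0 b) Gamma d) phi.
Proof.
move=> hd hb G0 Gd dC x xdom xC xdec.
have [l [xl phil]] := dC x xdom (zhong_cauchy hd hb G0 Gd xC) xdec.
by exists l; split=> //; exact: zhong_converges.
Qed.

(** * Ekeland's variational principle *)

(** Aim at the midpoint between [F x] and the infimum over [S]: from [y] the
    value of [F] can then decrease no more than it did from [x] to [y].
    Measuring precision by the progress just made, and not by a prescribed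
    sequence of tolerances, makes the choice of [y] depend on [x] alone, so that
    a plain iteration produces the minimizing chain. *)
Lemma dominated_minimizer (R : realType) (M : Type) (S : set M) (F : M -> R)
    (x : M) :
  S x -> has_lbound (F @` S) ->
  exists2 y, S y & forall z, S z -> F y - F z <= F x - F y.
Proof.
move=> Sx lbF.
have infF z : S z -> inf (F @` S) <= F z.
  by move=> Sz; apply: ge_inf => //; exists z.
have := infF x Sx; rewrite le_eqVlt => /predU1P[eqF|ltF].
  by exists x => // z /infF; rewrite eqF; lra.
have gap : 0 < (F x - inf (F @` S)) / 2 by lra.
have hasinf : has_inf (F @` S) by split=> //; exists (F x), x.
have [_ [y Sy <-] Fy] := inf_adherent gap hasinf.
by exists y => // z /infF; lra.
Qed.

(** Iterate the choice of almost minimizers in the sections [S x]. Along the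
    chain the values of [phi] decrease to a finite limit, so consecutive drops
    vanish; the drops bound both the distances, which makes the chain Cauchy,
    and the decrease still possible from any later point, which makes its limit
    minimal. *)
Lemma ekeland (R : realType) (M : Type) (e : M -> M -> R) (phi : M -> \bar R)
    (u : M) :
  almost_metric e -> inf_proper phi -> descending_complete e phi ->
  edom phi u ->
  exists v : M, [/\ edom phi v, ((e u v)%:E <= phi u - phi v)%E
    & forall x, x <> v -> (phi v - phi x < (e v x)%:E)%E].
Proof.
move=> [e0 etri eeq] [_ infphi] eC udom.
have infle x : (inf_value phi <= phi x)%E by apply: ereal_inf_lbound; exists x.
have inffin : inf_value phi \is a fin_num.
  by rewrite fin_numE gt_eqF //= lt_eqF // (le_lt_trans (infle u)).
pose F x := fine (phi x).
have FE x : edom phi x -> phi x = (F x)%:E.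
  move=> xdom; rewrite /F fineK // fin_numE gt_eqF ?lt_eqF //.
  exact: lt_le_trans infphi (infle x).
have Flb x : edom phi x -> fine (inf_value phi) <= F x.
  by move=> xdom; rewrite -lee_fin -FE // fineK.
pose S x := [set y | edom phi y /\ F y + e x y <= F x].
have Srefl x : edom phi x -> S x x.
  by move=> xdom; split=> //; rewrite ((eeq x x).2 erefl) addr0.
have Strans x y z : S x y -> S y z -> S x z.
  by move=> [_ xy] [zdom yz]; split=> //; have := etri x y z; lra.
have SF x y : S x y -> F y <= F x by move=> [_]; have := e0 x y; lra.
have step x : exists y, edom phi x ->
    S x y /\ forall z, S x z -> F y - F z <= F x - F y.
  have [xdom|] := pselect (edom phi x); last by exists x.
  have lbF : has_lbound (F @` S x).
    by exists (fine (inf_value phi)) => _ [z [zdom _] <-]; exact: Flb.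
  have [y Sy ymin] := dominated_minimizer (Srefl x xdom) lbF.
  by exists y.
have [g gP] := choice step.
pose x n := iter n g u.
have xdom n : edom phi (x n).
  by elim: n => [//|n IH]; have [[]] := gP _ IH.
have xS p q : (p <= q)%N -> S (x p) (x q).
  move=> /subnKC <-; elim: (q - p)%N => [|k IH].
    by rewrite addn0; exact: Srefl.
  rewrite addnS; apply: Strans IH _.
  by have [] := gP _ (xdom (p + k)%N).
have rF : has_inf (range (F \o x)).
  split; first by exists (F (x 0%N)), 0%N.
  by exists (fine (inf_value phi)) => _ [n _ <-]; exact: Flb.
have Fsmall eps : 0 < eps -> exists n, forall p q, (n <= p)%N ->
    F (x p) - F (x q) <= eps.
  move=> eps0; have [_ [n _ <-] /= Fn] := inf_adherent eps0 rF.
  exists n => p q np.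
  have : inf (range (F \o x)) <= F (x q) by apply: ge_inf rF.2 _ _; exists q.
  by have := SF _ _ (xS n p np); lra.
have xC : d_cauchy e x.
  move=> eps eps0; have [n Fn] := Fsmall eps eps0.
  exists n => p q np pq; have [_] := xS p q pq.
  by have := Fn p q np; lra.
have xdec : nonincreasing_seq (fun n => phi (x n)).
  by move=> p q pq; rewrite !FE // lee_fin; exact/SF/xS.
have [v [xv phiv]] := eC x xdom xC xdec.
have vle n : (phi v <= phi (x n))%E.
  apply: le_trans phiv _.
  rewrite (cvg_lim (@ereal_hausdorff R) (ereal_nonincreasing_cvgn xdec)).
  by apply: ereal_inf_lbound; exists n.
have vdom : edom phi v by exact: le_lt_trans (vle 0%N) udom.
have Fvle n : F v <= F (x n) by rewrite -lee_fin -!FE.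
(* The section is closed along the chain: let the intermediate index go to
   infinity in the triangle inequality through it. *)
have Sv n : S (x n) v.
  split=> //; apply/ler_addgt0Pr => eps eps0.
  have /cvgr0_norm_le /(_ eps eps0) [N _ /(_ (maxn n N))] := xv.
  rewrite /= leq_maxr => /(_ isT); rewrite ger0_norm // => evN.
  have [_] := xS n (maxn n N) (leq_maxl _ _).
  have := etri (x n) (x (maxn n N)) v.
  have := Fvle (maxn n N); lra.
(* A point [z] of [S v] lies in every [S (x N)], so [F (x N.+1) - F z] is at
   most the drop from [x N] to [x N.+1]. *)
have vmin z : S v z -> z = v.
  move=> Svz; have Fvz : F v <= F z.
    apply/ler_addgt0Pr => eps eps0.
    have [N /(_ N N.+1 (leqnn N)) FN] := Fsmall eps eps0.
    have [_ /(_ z (Strans _ _ _ (Sv N) Svz))] := gP _ (xdom N).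
    by have := Fvle N.+1; rewrite /= in FN *; lra.
  have [_ evz] := Svz; apply/esym/eeq/le_anti; rewrite e0 andbT; lra.
exists v; split=> //.
- by have [_] := Sv 0%N; rewrite /x /= !FE // -EFinB lee_fin; lra.
- move=> z zv; have [zdom|zNdom] := pselect (edom phi z).
    rewrite !FE // -EFinB lte_fin ltNge; apply/negP => evz.
    by apply: zv; apply: vmin; split=> //; lra.
  have -> : phi z = +oo%E.
    by apply/eqP; rewrite -leye_eq leNgt; exact/negP.
  by rewrite FE //= ltNyr.
Qed.

(** * Existence and location of the variational point *)

Theorem theorem5 (R : realType) (M : Type) (hM : inhabited M)
  (d : M -> M -> R) (hd : almost_metric d)
  (phi : M -> \bar R) (hphi : forall x, phi x <> -oo%E)
  (hproper : inf_proper phi) (hcomplete : descending_complete d phi)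
  (b : R -> R) (hb : normal_function b)
  (Gamma : M -> R) (hGamma0 : forall x, 0 <= Gamma x)
  (hGamma : almost_nonexpansive d Gamma) :
  let B := primitive0 b in
  let e := zhong_metric B Gamma d in
  (forall u : M, edom phi u ->
     exists v : M,
       [/\ edom phi v,
           b (Gamma u + d u v) * d u v <= e u v /\
             ((e u v)%:E <= phi u - phi v)%E
         & forall x : M, x <> v ->
             e v x <= b (Gamma v) * d v x /\
             (phi v - phi x < (e v x)%:E)%E])
  /\
  (forall (u : M) (rho : R), edom phi u -> 0 < rho ->
     (phi u - inf_value phi <= (B (Gamma u + rho) - B (Gamma u))%:E)%E ->
     forall v : M, edom phi v ->
       b (Gamma u + d u v) * d u v <= e u v /\
         ((e u v)%:E <= phi u - phi v)%E ->
       [/\ d u v <= rho,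
           Gamma v <= Gamma u + rho,
           ((b (Gamma u + rho) * d u v)%:E <= phi u - phi v)%E
         & (phi v <= phi u)%E]).
Proof.
move=> B e; have [d0 _ _] := hd.
have ebounds x y := zhong_bounds hb hGamma0 (d0 x y).
split.
- move=> u udom.
  have em := zhong_almost_metric hd hb hGamma0 hGamma.
  have ec := zhong_descending_complete hd hb hGamma0 hGamma hcomplete.
  have [v [vdom euv vmin]] := ekeland em hproper ec udom.
  exists v; split=> // [|x xv].
    by split=> //; have /andP[] := ebounds u v.
  by split; [have /andP[] := ebounds v x|exact: vmin].
- move=> u rho udom rho0 gap v vdom [lo euv].
  have [bmono bpos _] := hb.
  have duv : d u v <= rho.
    (* Otherwise [B] increases strictly from [Gamma u + rho] to
       [Gamma u + d u v], so [e u v] exceeds the largest drop available. *)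
    rewrite leNgt; apply/negP => rho_lt.
    have Blt : B (Gamma u + rho) < B (Gamma u + d u v).
      by apply: primitive0_lt; rewrite ?ltrD2l // addr_ge0 // ltW.
    have : ((e u v)%:E <= (B (Gamma u + rho) - B (Gamma u))%:E)%E.
      apply: le_trans euv (le_trans _ gap).
      by apply: leeB => //; apply: ereal_inf_lbound; exists v.
    by rewrite lee_fin /e /zhong_metric; lra.
  have evu : ((b (Gamma u + rho) * d u v)%:E <= phi u - phi v)%E.
    apply: le_trans euv; rewrite lee_fin; apply: le_trans lo.
    by apply: ler_wpM2r => //; apply: bmono; rewrite ?addr_ge0 ?lerD2l.
  split=> //.
    by have := hGamma u v; lra.
  have vfin : phi v \is a fin_num.
    by rewrite fin_numE (lt_eqF vdom) andbT; apply/eqP.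
  suff : (0 <= phi u - phi v)%E by rewrite sube_ge0 ?vfin.
  apply: le_trans evu.
  by rewrite lee_fin mulr_ge0 // ltW // bpos // addr_ge0 // ltW.
Qed.
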